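(* Let $\mathcal{C}$ be a Galoisien category, let $E$ be a Gysin functor on $\mathcal{C}$, and let $X$ be an object of $\mathcal{C}$ that is Galois. Then in the category of correspondences $\mathcal{C}_E$ one has an isomorphism of rings $$\mathrm{End}_{\mathcal{C}_E}(X)\cong \widetilde{[\mathrm{Aut}_{\mathcal{C}}(X)]}E(X),$$ where the right-hand side is the twisted group ring whose elements are finite formal sums $\sum_i [g_i]a_i$ with $g_i\in\mathrm{Aut}_{\mathcal{C}}(X)$ and $a_i\in E(X)$, with multiplication determined by $$[g]a\cdot[h]b=[gh](h^*a\cdot b).$$ Here $[g]a$ corresponds to the element $Rg\circ Da$ of $\mathrm{End}_{\mathcal{C}_E}(X)$.
   Context: Finitary lextensive category: a category $\mathcal{C}$ with finite limits and finite coproducts such that (i) for all maps $A\to X$, $P_1\to X$, $P_2\to X$ the natural map $(A\times_X P_1)\amalg (A\times_X P_2)\to A\times_X(P_1\amalg P_2)$ is an isomorphism; (ii) for all objects $A,B$, with coproduct inclusions $i_0\colon A\to A\amalg B$, $i_1\colon B\to A\amalg B$, one has that $A$ (with identity maps) is the pullback of $A\xrightarrow{i_0}A\amalg B\xleftarrow{i_0}A$, $B$ (with identity maps) is the pullback of $B\xrightarrow{i_1}A\amalg B\xleftarrow{i_1}B$, and $\emptyset$ is the pullback of $A\xrightarrow{i_0}A\amalg B\xleftarrow{i_1}B$. An object $X$ is atomic if $X\neq\emptyset$ (the initial object) and $X$ is not isomorphic to a coproduct $A\amalg B$ with both $A$ and $B$ different from the initial object. A Galoisien category is a finitary lextensive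 category $\mathcal{C}$ such that: if $X$ is atomic and $Y,Z$ are any objects then the natural map $\mathcal{C}(X,Y)\amalg\mathcal{C}(X,Z)\to\mathcal{C}(X,Y\amalg Z)$ is a bijection; for every atomic $X$ the group $\mathrm{Aut}(X)$ is finite; and if $X\neq\emptyset$ then $\mathcal{C}(X,\emptyset)=\emptyset$. An object $Y$ is Galois if the map $\coprod_{\sigma\in\mathrm{Aut}(Y)}Y_\sigma\to Y\times Y$ is an isomorphism, where $Y_\sigma$ is a copy of $Y$ and $Y_\sigma\to Y\times Y$ is the map with components $(\mathrm{id},\sigma)$. Gysin functor on $\mathcal{C}$: a contravariant functor $E$ from $\mathcal{C}$ to commutative rings together with a covariant functor $\tilde E$ from $\mathcal{C}$ to abelian groups with $\tilde E(X)=E(X)$ (as abelian groups) for all $X$. For $f\colon X\to Y$ write $f^*=E(f)\colon E(Y)\to E(X)$ and $f_!=\tilde E(f)\colon E(X)\to E(Y)$; for $a\in E(X)$, $b\in E(Y)$ write $a\otimes b=(\pi_X)^*(a)\cdot(\pi_Y)^*(b)\in E(X\times Y)$, with $\pi_X,\pi_Y$ the projections of $X\times Y$. Axioms: (1) $E(\emptyset)=0$; (2) $(i_X^*,i_Y^* )\colon E(X\amalg Y)\to E(X)\times E(Y)$ is an isomorphism of rings; (3) $(f\times g)_!(a\otimes b)=f_!(a)\otimes g_!(b)$ for all $f\colon X\to X'$, $g\colon Y\to Y'$, $a\in E(X)$, $b\in E(Y)$; (4) for every pullback square with $f\colon A\to B$, $p\colon A\to C$, $q\colon B\to D$, $g\colon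 C\to D$ ($qf=gp$), one has $f_!p^*=q^*g_!$. The category $\mathcal{C}_E$ of $E$-correspondences: same objects as $\mathcal{C}$; $\mathcal{C}_E(A,B)=E(B\times A)$ as abelian group; the composite of $\beta\in\mathcal{C}_E(A,B)$ and $\alpha\in\mathcal{C}_E(B,C)$ is $\alpha\circ\beta=(\pi_{13})_!\big(\pi_{12}^*(\alpha)\cdot\pi_{23}^*(\beta)\big)$, with $\pi_{12},\pi_{13},\pi_{23}$ the projections from $C\times B\times A$ to $C\times B$, $C\times A$, $B\times A$; the identity of $A$ is $i_A=(\Delta_A)_!(1)\in E(A\times A)$, with $\Delta_A\colon A\to A\times A$ the diagonal. For $f\colon A\to B$ in $\mathcal{C}$: $Rf=(\mathrm{id}_B\times f)^*(i_B)\in E(B\times A)=\mathcal{C}_E(A,B)$. For $a\in E(X)$: $Da=(\Delta_X)_!(a)\in E(X\times X)=\mathcal{C}_E(X,X)$. *)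

(* Defs.v *)
From HB Require Import structures.
From mathcomp Require Import all_boot all_algebra finmap.
From mathcomp Require Import boolp.
From mathcomp.multinomials Require Import monalg.

Set Implicit Arguments.
Unset Strict Implicit.
Unset Printing Implicit Defensive.

Import GRing.Theory.

Declare Scope cat_scope.
Delimit Scope cat_scope with cat.
Local Open Scope ring_scope.
Local Open Scope cat_scope.

Reserved Notation "g ∘ f" (at level 40, left associativity).
Reserved Notation "A × B" (at level 40, left associativity).
Reserved Notation "A ⊔ B" (at level 50, left associativity).
Reserved Notation "A ≅ B" (at level 70, no associativity).
Reserved Notation "a ⊠ b" (at level 40, left associativity).

Record category := Category {
  obj :> Type;
  hom : obj -> obj -> Type;
  idm : forall a, hom a a;
  mcomp : forall a b c, hom b c -> hom a b -> hom a c;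
  compA : forall a b c d (h : hom c d) (g : hom b c) (f : hom a b),
    mcomp (mcomp h g) f = mcomp h (mcomp g f);
  comp1m : forall a b (f : hom a b), mcomp (idm b) f = f;
  compm1 : forall a b (f : hom a b), mcomp f (idm a) = f
}.
Arguments hom {C} A B : rename.
Arguments idm {C} A : rename.
Notation "g ∘ f" := (mcomp g f) : cat_scope.

Definition is_iso (C : category) (A B : C) (f : hom A B) : Prop :=
  exists g : hom B A, g ∘ f = idm A /\ f ∘ g = idm B.

Definition isomorphic (C : category) (A B : C) : Prop :=
  exists f : hom A B, is_iso f.
Notation "A ≅ B" := (isomorphic A B) : cat_scope.

(* The commutative square  q ∘ f = g ∘ p  is cartesian:
     A --f--> B
     |p       |q
     C --g--> D                                              *)
Definition is_pullback (C : category) (a b c d : C)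
    (f : hom a b) (p : hom a c) (q : hom b d) (g : hom c d) : Prop :=
  q ∘ f = g ∘ p /\
  forall (t : C) (u : hom t b) (v : hom t c), q ∘ u = g ∘ v ->
    exists! w : hom t a, f ∘ w = u /\ p ∘ w = v.

(* A category with a choice of finite limits (generated by a terminal object,
   binary products and pullbacks) and of finite coproducts (generated by an
   initial object and binary coproducts). *)
Record fincat := Fincat {
  fin_cat :> category;
  terminal : fin_cat;
  to_terminal : forall a : fin_cat, hom a terminal;
  to_terminal_uniq : forall (a : fin_cat) (f : hom a terminal),
    f = to_terminal a;
  prd : fin_cat -> fin_cat -> fin_cat;
  prd1 : forall a b, hom (prd a b) a;
  prd2 : forall a b, hom (prd a b) b;
  mpair : forall t a b : fin_cat, hom t a -> hom t b -> hom t (prd a b);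
  prd1_pair : forall (t a b : fin_cat) (u : hom t a) (v : hom t b),
    prd1 a b ∘ mpair u v = u;
  prd2_pair : forall (t a b : fin_cat) (u : hom t a) (v : hom t b),
    prd2 a b ∘ mpair u v = v;
  pair_uniq : forall (t a b : fin_cat) (w : hom t (prd a b)),
    w = mpair (prd1 a b ∘ w) (prd2 a b ∘ w);
  pb : forall a b x : fin_cat, hom a x -> hom b x -> fin_cat;
  pb1 : forall (a b x : fin_cat) (f : hom a x) (g : hom b x), hom (pb f g) a;
  pb2 : forall (a b x : fin_cat) (f : hom a x) (g : hom b x), hom (pb f g) b;
  pb_comm : forall (a b x : fin_cat) (f : hom a x) (g : hom b x),
    f ∘ pb1 f g = g ∘ pb2 f g;
  pb_lift : forall (a b x : fin_cat) (f : hom a x) (g : hom b x)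
    (t : fin_cat) (u : hom t a) (v : hom t b), f ∘ u = g ∘ v ->
    hom t (pb f g);
  pb1_lift : forall (a b x : fin_cat) (f : hom a x) (g : hom b x)
    (t : fin_cat) (u : hom t a) (v : hom t b) (e : f ∘ u = g ∘ v),
    pb1 f g ∘ pb_lift e = u;
  pb2_lift : forall (a b x : fin_cat) (f : hom a x) (g : hom b x)
    (t : fin_cat) (u : hom t a) (v : hom t b) (e : f ∘ u = g ∘ v),
    pb2 f g ∘ pb_lift e = v;
  pb_lift_uniq : forall (a b x : fin_cat) (f : hom a x) (g : hom b x)
    (t : fin_cat) (w w' : hom t (pb f g)),
    pb1 f g ∘ w = pb1 f g ∘ w' -> pb2 f g ∘ w = pb2 f g ∘ w' -> w = w';
  initial : fin_cat;
  from_initial : forall a : fin_cat, hom initial a;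
  from_initial_uniq : forall (a : fin_cat) (f : hom initial a),
    f = from_initial a;
  cprd : fin_cat -> fin_cat -> fin_cat;
  inj1 : forall a b, hom a (cprd a b);
  inj2 : forall a b, hom b (cprd a b);
  copair : forall a b t : fin_cat, hom a t -> hom b t -> hom (cprd a b) t;
  copair_inj1 : forall (a b t : fin_cat) (u : hom a t) (v : hom b t),
    copair u v ∘ inj1 a b = u;
  copair_inj2 : forall (a b t : fin_cat) (u : hom a t) (v : hom b t),
    copair u v ∘ inj2 a b = v;
  copair_uniq : forall (a b t : fin_cat) (w : hom (cprd a b) t),
    w = copair (w ∘ inj1 a b) (w ∘ inj2 a b)
}.
Arguments initial {C} : rename.
Arguments terminal {C} : rename.
Arguments prd {C} A B : rename.
Arguments prd1 {C} A B : rename.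
Arguments prd2 {C} A B : rename.
Arguments cprd {C} A B : rename.
Arguments inj1 {C} A B : rename.
Arguments inj2 {C} A B : rename.
Notation "A × B" := (prd A B) : cat_scope.
Notation "A ⊔ B" := (cprd A B) : cat_scope.

Definition diag (C : fincat) (A : C) : hom A (A × A) := mpair (idm A) (idm A).

Definition mprod (C : fincat) (A A' B B' : C) (f : hom A A') (g : hom B B') :
    hom (A × B) (A' × B') :=
  mpair (f ∘ prd1 A B) (g ∘ prd2 A B).

Section Distributivity.
Variables (C : fincat) (A X P1 P2 : C).
Variables (f : hom A X) (p1 : hom P1 X) (p2 : hom P2 X).

Lemma dist_comm1 : f ∘ pb1 f p1 = copair p1 p2 ∘ (inj1 P1 P2 ∘ pb2 f p1).
Proof. by rewrite -compA copair_inj1 pb_comm. Qed.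

Lemma dist_comm2 : f ∘ pb1 f p2 = copair p1 p2 ∘ (inj2 P1 P2 ∘ pb2 f p2).
Proof. by rewrite -compA copair_inj2 pb_comm. Qed.

(* The natural map (A ×_X P1) ⊔ (A ×_X P2) -> A ×_X (P1 ⊔ P2). *)
Definition dist_map : hom (pb f p1 ⊔ pb f p2) (pb f (copair p1 p2)) :=
  copair (pb_lift dist_comm1) (pb_lift dist_comm2).
End Distributivity.

Definition lextensive (C : fincat) : Prop :=
  (forall (A X P1 P2 : C) (f : hom A X) (p1 : hom P1 X) (p2 : hom P2 X),
     is_iso (dist_map f p1 p2)) /\
  (forall A B : C,
     [/\ is_pullback (idm A) (idm A) (inj1 A B) (inj1 A B),
         is_pullback (idm B) (idm B) (inj2 A B) (inj2 A B) &
         is_pullback (from_initial A) (from_initial B)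
                     (inj1 A B) (inj2 A B)]).

Record aut (C : category) (X : C) := Aut {
  aut_hom :> hom X X;
  aut_isoP : is_iso aut_hom
}.

Section AutGroup.
Variables (C : category) (X : C).

HB.instance Definition _ := gen_eqMixin (aut X).
HB.instance Definition _ := gen_choiceMixin (aut X).

Lemma aut_inj (g h : aut X) : aut_hom g = aut_hom h -> g = h.
Proof.
by case: g h => [g Hg] [h Hh] /= gh; case: h / gh Hh => Hh; congr Aut;
  apply: Prop_irrelevance.
Qed.

Lemma aut_mul_subproof (g h : aut X) : is_iso (aut_hom g ∘ aut_hom h).
Proof.
case: g h => [g [g' [g'g gg']]] [h [h' [h'h hh']]] /=; exists (h' ∘ g'); split.
  by rewrite compA -(compA g') g'g comp1m.
by rewrite compA -(compA h) hh' comp1m.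
Qed.
Definition aut_mul (g h : aut X) : aut X := Aut (aut_mul_subproof g h).

Lemma aut_one_subproof : is_iso (idm X).
Proof. by exists (idm X); rewrite comp1m. Qed.
Definition aut_one : aut X := Aut aut_one_subproof.

Lemma aut_inv_subproof (g : aut X) :
  is_iso (sval (cid (aut_isoP g))).
Proof. by case: cid => g' [/= g'g gg']; exists (aut_hom g). Qed.
Definition aut_inv (g : aut X) : aut X := Aut (aut_inv_subproof g).

Lemma aut_mulA : associative aut_mul.
Proof. by move=> f g h; apply: aut_inj; rewrite /= compA. Qed.
Lemma aut_mul1 : left_id aut_one aut_mul.
Proof. by move=> g; apply: aut_inj; rewrite /= comp1m. Qed.
Lemma aut_mulg1 : right_id aut_one aut_mul.
Proof. by move=> g; apply: aut_inj; rewrite /= compm1. Qed.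
Lemma aut_mulV : left_inverse aut_one aut_inv aut_mul.
Proof. by move=> g; apply: aut_inj => /=; case: cid => g' []. Qed.
Lemma aut_mulgV : right_inverse aut_one aut_inv aut_mul.
Proof. by move=> g; apply: aut_inj => /=; case: cid => g' []. Qed.

HB.instance Definition _ := isGroup.Build (aut X)
  aut_mulA aut_mul1 aut_mulg1 aut_mulV aut_mulgV.

End AutGroup.

Definition atomic (C : fincat) (X : C) : Prop :=
  ~ (X ≅ initial) /\
  ~ (exists A B : C, [/\ ~ (A ≅ initial), ~ (B ≅ initial) & X ≅ A ⊔ B]).

Definition enumerates (T : eqType) (s : seq T) : Prop :=
  uniq s /\ forall x, x \in s.

Definition cprd_hom (C : fincat) (X Y Z : C) (u : hom X Y + hom X Z) :
    hom X (Y ⊔ Z) :=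
  match u with
  | inl f => inj1 Y Z ∘ f
  | inr g => inj2 Y Z ∘ g
  end.

Definition galoisien (C : fincat) : Prop :=
  [/\ lextensive C,
      forall X : C, atomic X -> forall Y Z : C, bijective (@cprd_hom C X Y Z),
      forall X : C, atomic X -> exists s : seq (aut X), enumerates s &
      forall X : C, ~ (X ≅ initial) -> hom X initial -> False].

Section FiniteCoproduct.
Variables (C : fincat) (I : Type) (F : I -> C).

Fixpoint bigcprd (s : seq I) : C :=
  if s is i :: s' then F i ⊔ bigcprd s' else initial.

Fixpoint bigcopair (T : C) (f : forall i, hom (F i) T) (s : seq I) :
    hom (bigcprd s) T :=
  match s with
  | [::] => from_initial T
  | i :: s' => copair (f i) (bigcopair f s')
  end.
End FiniteCoproduct.

(* The coproduct indexed by Aut(Y) is taken in a category with finite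
   coproducts, so Aut(Y) is finite for a Galois object Y. *)
Definition galois (C : fincat) (Y : C) : Prop :=
  exists s : seq (aut Y), enumerates s /\
    is_iso (bigcopair (F := fun=> Y) (fun g : aut Y => mpair (idm Y) g) s).

Record gysin_data (C : fincat) := GysinData {
  gysin_obj :> C -> comPzRingType;
  pull : forall X Y : C, hom X Y -> {rmorphism gysin_obj Y -> gysin_obj X};
  push : forall X Y : C, hom X Y -> {additive gysin_obj X -> gysin_obj Y};
  pull_id : forall (X : C) (a : gysin_obj X), pull (idm X) a = a;
  pull_comp : forall (X Y Z : C) (g : hom Y Z) (f : hom X Y) (a : gysin_obj Z),
    pull (g ∘ f) a = pull f (pull g a);
  push_id : forall (X : C) (a : gysin_obj X), push (idm X) a = a;
  push_comp : forall (X Y Z : C) (g : hom Y Z) (f : hom X Y) (a : gysin_obj X),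
    push (g ∘ f) a = push g (push f a)
}.
Arguments pull {C} E {X Y} f : rename.
Arguments push {C} E {X Y} f : rename.

Definition ext (C : fincat) (E : gysin_data C) (X Y : C) (a : E X) (b : E Y) :
    E (X × Y) :=
  pull E (prd1 X Y) a * pull E (prd2 X Y) b.
Notation "a ⊠ b" := (ext a b) : cat_scope.

Record gysin (C : fincat) := Gysin {
  gysin_fun :> gysin_data C;
  gysin_initial : forall a : gysin_fun initial, a = 0;
  gysin_cprd : forall X Y : C,
    bijective (fun c : gysin_fun (X ⊔ Y) =>
      (pull gysin_fun (inj1 X Y) c, pull gysin_fun (inj2 X Y) c));
  gysin_ext : forall (X X' Y Y' : C) (f : hom X X') (g : hom Y Y')
      (a : gysin_fun X) (b : gysin_fun Y),
    push gysin_fun (mprod f g) (a ⊠ b) =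
    push gysin_fun f a ⊠ push gysin_fun g b;
  gysin_mackey : forall (A B C' D : C) (f : hom A B) (p : hom A C')
      (q : hom B D) (g : hom C' D), is_pullback f p q g ->
    forall a : gysin_fun C',
      push gysin_fun f (pull gysin_fun p a) =
      pull gysin_fun q (push gysin_fun g a)
}.

Section Correspondences.
Variables (C : fincat) (E : gysin C).
Implicit Types X Y A B D : C.

(* The triple product Z × Y × X is taken to be Z × (Y × X). *)
Definition pi12 X Y Z : hom (Z × (Y × X)) (Z × Y) :=
  mpair (prd1 Z (Y × X)) (prd1 Y X ∘ prd2 Z (Y × X)).
Definition pi13 X Y Z : hom (Z × (Y × X)) (Z × X) :=
  mpair (prd1 Z (Y × X)) (prd2 Y X ∘ prd2 Z (Y × X)).
Definition pi23 X Y Z : hom (Z × (Y × X)) (Y × X) := prd2 Z (Y × X).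

Definition corr A B : zmodType := E (B × A).

Definition corr_comp A B D (alpha : corr B D) (beta : corr A B) : corr A D :=
  push E (pi13 A B D) (pull E (pi12 A B D) alpha * pull E (pi23 A B D) beta).

Definition corr_id A : corr A A := push E (diag A) 1.

Lemma pair_comp (S T A B : C) (u : hom T A) (v : hom T B) (w : hom S T) :
  mpair u v ∘ w = mpair (u ∘ w) (v ∘ w).
Proof. by rewrite [LHS]pair_uniq -!compA prd1_pair prd2_pair. Qed.

Definition pairE := (compA, comp1m, compm1, pair_comp, prd1_pair, prd2_pair).

Lemma prd_ext (T A B : C) (u v : hom T (A × B)) :
  prd1 A B ∘ u = prd1 A B ∘ v -> prd2 A B ∘ u = prd2 A B ∘ v -> u = v.
Proof. by move=> e1 e2; rewrite (pair_uniq u) e1 e2 -pair_uniq. Qed.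

Lemma is_pullbackI (a b c d : C) (f : hom a b) (p : hom a c) (q : hom b d)
    (g : hom c d) : q ∘ f = g ∘ p ->
  (forall (t : C) (u : hom t b) (v : hom t c), q ∘ u = g ∘ v ->
     exists w : hom t a, f ∘ w = u /\ p ∘ w = v) ->
  (forall (t : C) (w w' : hom t a), f ∘ w = f ∘ w' -> p ∘ w = p ∘ w' ->
     w = w') ->
  is_pullback f p q g.
Proof.
move=> e ex un; split=> // t u v /ex[w [fw pw]]; exists w; split=> // w' [fw' pw'].
by apply: un; rewrite ?fw ?pw.
Qed.

(* Projection formula. *)
Lemma push_pullM X Y (f : hom X Y) (a : E Y) (b : E X) :
  push E f (pull E f a * b) = a * push E f b.
Proof.
have pbk : is_pullback f (mpair f (idm X)) (diag Y) (mprod (idm Y) f).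
  apply: is_pullbackI.
  - by rewrite /mprod /diag !pairE.
  - move=> t u v e; exists (prd2 Y X ∘ v).
    have := congr1 (mcomp (prd1 Y Y)) e; rewrite /mprod /diag !pairE => e1.
    have := congr1 (mcomp (prd2 Y Y)) e; rewrite /mprod /diag !pairE => e2.
    split; first by rewrite -e2.
    by apply: prd_ext; rewrite !pairE // -e1.
  - move=> t w w' _ /(congr1 (mcomp (prd2 Y X))).
    by rewrite !pairE.
have := gysin_mackey pbk (a ⊠ b).
rewrite gysin_ext /ext !rmorphM -!pull_comp /diag !pairE push_id !pull_id.
by [].
Qed.

Lemma push_Mpull X Y (f : hom X Y) (a : E Y) (b : E X) :
  push E f (b * pull E f a) = push E f b * a.
Proof. by rewrite mulrC push_pullM mulrC. Qed.

Lemma corr_compA X Y Z W (a : corr Z W) (b : corr Y Z) (c : corr X Y) :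
  corr_comp (corr_comp a b) c = corr_comp a (corr_comp b c).
Proof.
pose T := W × (Z × (Y × X)).
pose x1 : hom T W := prd1 _ _.
pose x2 : hom T Z := prd1 _ _ ∘ prd2 _ _.
pose x3 : hom T Y := prd1 _ _ ∘ (prd2 _ _ ∘ prd2 _ _).
pose x4 : hom T X := prd2 _ _ ∘ (prd2 _ _ ∘ prd2 _ _).
pose q1 : hom T (W × (Y × X)) := mpair x1 (mpair x3 x4).
pose r1 : hom T (W × (Z × Y)) := mpair x1 (mpair x2 x3).
pose q2 : hom T (W × (Z × X)) := mpair x1 (mpair x2 x4).
pose r2 : hom T (Z × (Y × X)) := mpair x2 (mpair x3 x4).
have pb1 : is_pullback q1 r1 (pi12 X Y W) (pi13 Y Z W).
  apply: is_pullbackI.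
  - by rewrite /q1 /r1 /pi12 /pi13 !pairE.
  - move=> t u v e.
    have := congr1 (mcomp (prd1 _ _)) e; rewrite /pi12 /pi13 !pairE => e1.
    have := congr1 (mcomp (prd2 _ _)) e; rewrite /pi12 /pi13 !pairE => e2.
    exists (mpair (prd1 _ _ ∘ u) (mpair (prd1 _ _ ∘ (prd2 _ _ ∘ v)) (prd2 _ _ ∘ u))).
    rewrite /q1 /r1 /x1 /x2 /x3 /x4; split; do ?apply: prd_ext;
      by rewrite !pairE.
  - move=> t w w' e e'.
    have E1 := congr1 (mcomp (prd1 _ _)) e.
    have E2 := congr1 (mcomp (prd2 _ _)) e.
    have E3 := congr1 (fun z => prd1 _ _ ∘ (prd2 _ _ ∘ z)) e'.
    have E4 := congr1 (fun z => prd1 _ _ ∘ z) E2.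
    have E5 := congr1 (fun z => prd2 _ _ ∘ z) E2.
    move: E1 E3 E4 E5; rewrite /q1 /r1 /x1 /x2 /x3 /x4 !pairE => *.
    by do ?apply: prd_ext.
have pb2 : is_pullback q2 r2 (pi23 X Z W) (pi13 X Y Z).
  apply: is_pullbackI.
  - by rewrite /q2 /r2 /pi23 /pi13 !pairE.
  - move=> t u v e.
    have := congr1 (mcomp (prd1 _ _)) e; rewrite /pi23 /pi13 !pairE => e1.
    have := congr1 (mcomp (prd2 _ _)) e; rewrite /pi23 /pi13 !pairE => e2.
    exists (mpair (prd1 _ _ ∘ u) v).
    rewrite /q2 /r2 /x1 /x2 /x3 /x4; split; do ?apply: prd_ext;
      by rewrite !pairE.
  - move=> t w w' e e'.
    have E1 := congr1 (mcomp (prd1 _ _)) e.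
    have E2 := congr1 (mcomp (prd1 _ _)) e'.
    have E3 := congr1 (mcomp (prd2 _ _)) e'.
    have E4 := congr1 (fun z => prd1 _ _ ∘ z) E3.
    have E5 := congr1 (fun z => prd2 _ _ ∘ z) E3.
    move: E1 E2 E4 E5; rewrite /q2 /r2 /x1 /x2 /x3 /x4 !pairE => *.
    by do ?apply: prd_ext.
rewrite /corr_comp.
rewrite -(gysin_mackey pb1) -(gysin_mackey pb2).
rewrite -push_Mpull -push_pullM -!push_comp !rmorphM -!pull_comp mulrA.
rewrite /q1 /r1 /q2 /r2 /pi12 /pi13 /pi23 !pairE.
by [].
Qed.

Lemma corr_comp1m X Y (b : corr X Y) : corr_comp (corr_id Y) b = b.
Proof.
pose e : hom (Y × X) (Y × (Y × X)) := mpair (prd1 Y X) (idm _).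
have pbk : is_pullback e (prd1 Y X) (pi12 X Y Y) (diag Y).
  apply: is_pullbackI.
  - by rewrite /e /pi12 /diag !pairE.
  - move=> t u v h.
    have := congr1 (mcomp (prd1 _ _)) h; rewrite /pi12 /diag !pairE => e1.
    have := congr1 (mcomp (prd2 _ _)) h; rewrite /pi12 /diag !pairE => e2.
    exists (prd2 _ _ ∘ u); rewrite /e; split; last by [].
    by apply: prd_ext; rewrite !pairE // e1 -e2.
  - move=> t w w' /(congr1 (mcomp (prd2 _ _))).
    by rewrite /e !pairE.
rewrite /corr_comp /corr_id -(gysin_mackey pbk) -push_Mpull -push_comp.
rewrite rmorph1 mul1r -pull_comp /pi13 /pi23 /e !pairE pull_id.
have -> : mpair (prd1 Y X) (prd2 Y X) = idm (Y × X).
  by apply: prd_ext; rewrite !pairE.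
by rewrite push_id.
Qed.

Lemma corr_compm1 X Y (b : corr X Y) : corr_comp b (corr_id X) = b.
Proof.
pose e : hom (Y × X) (Y × (X × X)) :=
  mpair (prd1 Y X) (mpair (prd2 Y X) (prd2 Y X)).
have pbk : is_pullback e (prd2 Y X) (pi23 X X Y) (diag X).
  apply: is_pullbackI.
  - by rewrite /e /pi23 /diag !pairE.
  - move=> t u v h.
    exists (mpair (prd1 _ _ ∘ u) v); rewrite /e; split; last by rewrite !pairE.
    by apply: prd_ext; rewrite !pairE // [RHS]h /diag !pairE.
  - move=> t w w' /(congr1 (mcomp (prd1 _ _))).
    by rewrite /e !pairE => e1 e2; apply: prd_ext.
rewrite /corr_comp /corr_id -(gysin_mackey pbk) -push_pullM -push_comp.
rewrite rmorph1 mulr1 -pull_comp /pi13 /pi12 /e !pairE.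
have -> : mpair (prd1 Y X) (prd2 Y X) = idm (Y × X).
  by apply: prd_ext; rewrite !pairE.
by rewrite push_id pull_id.
Qed.

Definition corr_cat : category :=
  Category corr_compA corr_comp1m corr_compm1.

Definition corr_R A B (f : hom A B) : @hom corr_cat A B :=
  pull E (mprod (idm B) f) (corr_id B).

Definition corr_D A (a : E A) : @hom corr_cat A A := push E (diag A) a.

End Correspondences.

Section EndRing.
Variables (C : fincat) (E : gysin C) (X : C).

Definition corr_end : Type := @hom (corr_cat E) X X.

HB.instance Definition _ := GRing.Zmodule.copy corr_end (corr E X X).

Definition corr_end_mul (a b : corr_end) : corr_end := a ∘ b.
Definition corr_end_one : corr_end := @idm (corr_cat E) X.

Lemma corr_end_mulDl : left_distributive corr_end_mul +%R.
Proof.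
move=> a b c; rewrite /corr_end_mul /= /corr_comp.
by rewrite -raddfD -mulrDl -raddfD.
Qed.

Lemma corr_end_mulDr : right_distributive corr_end_mul +%R.
Proof.
move=> a b c; rewrite /corr_end_mul /= /corr_comp.
by rewrite -raddfD -mulrDr -raddfD.
Qed.

HB.instance Definition _ := GRing.Zmodule_isPzRing.Build corr_end
  (fun a b c => esym (@compA (corr_cat E) X X X X a b c))
  (@comp1m (corr_cat E) X X) (@compm1 (corr_cat E) X X)
  corr_end_mulDl corr_end_mulDr.

End EndRing.

Section TwistedGroupRing.
Variables (C : fincat) (E : gysin C) (X : C).
Local Open Scope fset_scope.
Local Open Scope ring_scope.

(* The formal sum  \sum_i [g_i] a_i  is  \sum_i << a_i *g g_i >>. *)
Definition twisted : Type := {malg (E X)[aut X]}.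

HB.instance Definition _ := GRing.Zmodule.copy twisted {malg (E X)[aut X]}.

Definition tmon (g : aut X) (a : E X) : twisted := << a *g g >>.

Definition twisted_mul (u v : twisted) : twisted :=
  \sum_(g <- msupp u) \sum_(h <- msupp v)
     tmon (g * h)%g (pull E h u@_g * v@_h).
Definition twisted_one : twisted := tmon 1%g 1.

Implicit Types u v w : twisted.

Let tmon0 (g : aut X) : tmon g 0 = 0. Proof. exact: monalgU0. Qed.
Let tmonD (g : aut X) (a b : E X) : tmon g (a + b) = tmon g a + tmon g b.
Proof. exact: monalgUD. Qed.

Lemma twisted_mulw (d1 d2 : {fset aut X}) u v :
  msupp u `<=` d1 -> msupp v `<=` d2 ->
  twisted_mul u v = \sum_(g <- d1) \sum_(h <- d2)
     tmon (g * h)%g (pull E h u@_g * v@_h).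
Proof.
move=> le_d1 le_d2; rewrite /twisted_mul (big_fset_incl _ le_d1) /=.
  apply/eq_bigr=> g _; apply/big_fset_incl => // k _ /mcoeff_outdom ->.
  by rewrite mulr0 tmon0.
move=> k _ /mcoeff_outdom uk.
by rewrite big1 => // k' _; rewrite uk rmorph0 mul0r tmon0.
Qed.

Lemma twisted_mulDl : left_distributive twisted_mul +%R.
Proof.
move=> u v w.
rewrite [in RHS](twisted_mulw (fsubsetUl _ (msupp v)) (fsubset_refl _)).
rewrite [in RHS](twisted_mulw (fsubsetUr (msupp u) _) (fsubset_refl _)).
rewrite (twisted_mulw (msuppD_le _ _) (fsubset_refl _)).
rewrite -big_split /=; apply/eq_bigr=> g _.
rewrite -big_split /=; apply/eq_bigr=> h _.
by rewrite mcoeffD rmorphD mulrDl tmonD.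
Qed.

Lemma twisted_mulDr : right_distributive twisted_mul +%R.
Proof.
move=> w u v.
rewrite [in RHS](twisted_mulw (fsubset_refl _) (fsubsetUl _ (msupp v))).
rewrite [in RHS](twisted_mulw (fsubset_refl _) (fsubsetUr (msupp u) _)).
rewrite (twisted_mulw (fsubset_refl _) (msuppD_le _ _)).
rewrite -big_split /=; apply/eq_bigr=> g _.
rewrite -big_split /=; apply/eq_bigr=> h _.
by rewrite mcoeffD mulrDr tmonD.
Qed.

Lemma twisted_mul0l : left_zero 0 twisted_mul.
Proof. by move=> u; rewrite /twisted_mul msupp0 big_seq_fset0. Qed.

Lemma twisted_mul0r : right_zero 0 twisted_mul.
Proof.
by move=> u; rewrite /twisted_mul big1 // => g _; rewrite msupp0 big_seq_fset0.
Qed.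

Lemma tmonM (g h : aut X) (a b : E X) :
  twisted_mul (tmon g a) (tmon h b) = tmon (g * h)%g (pull E h a * b).
Proof. by rewrite (twisted_mulw msuppU_le msuppU_le) !big_seq_fset1 !mcoeffUU. Qed.

Lemma twisted_ind (P : twisted -> Prop) :
  P 0 -> (forall u v, P u -> P v -> P (u + v)) ->
  (forall g a, P (tmon g a)) -> forall u, P u.
Proof. by move=> P0 PD PU u; rewrite (monalgE u); apply: big_ind. Qed.

Lemma twisted_mulA : associative twisted_mul.
Proof.
move=> u v w; elim/twisted_ind: u => [|u u' IH IH'|g a].
- by rewrite !twisted_mul0l.
- by rewrite !twisted_mulDl IH IH'.
elim/twisted_ind: v => [|v v' IH IH'|h b].
- by rewrite !(twisted_mul0l, twisted_mul0r).
- by rewrite !(twisted_mulDl, twisted_mulDr) IH IH'.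
elim/twisted_ind: w => [|w w' IH IH'|k c].
- by rewrite !twisted_mul0r.
- by rewrite !twisted_mulDr IH IH'.
by rewrite !tmonM mulgA pull_comp rmorphM mulrA.
Qed.

Lemma twisted_mul1l : left_id twisted_one twisted_mul.
Proof.
elim/twisted_ind => [|u u' IH IH'|g a].
- by rewrite !twisted_mul0r.
- by rewrite !twisted_mulDr IH IH'.
by rewrite tmonM rmorph1 mul1r mul1g.
Qed.

Lemma twisted_mul1r : right_id twisted_one twisted_mul.
Proof.
elim/twisted_ind => [|u u' IH IH'|g a].
- by rewrite !twisted_mul0l.
- by rewrite !twisted_mulDl IH IH'.
by rewrite tmonM pull_id mulr1 mulg1.
Qed.

HB.instance Definition _ := GRing.Zmodule_isPzRing.Build twisted
  twisted_mulA twisted_mul1l twisted_mul1r twisted_mulDl twisted_mulDr.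

End TwistedGroupRing.

(* Main.v *)
From HB Require Import structures.
From mathcomp Require Import all_boot all_algebra.
From mathcomp Require Import boolp.
From mathcomp.multinomials Require Import monalg.
Require Import Defs.

(** For [f : A -> B] and [a] in [E A], push [a] forward along the graph
    [(f, id) : A -> B × A]; this gives a correspondence [graph_corr f a] from
    [A] to [B].  Base change and the projection formula give
      [graph_corr f a ∘ graph_corr h b = graph_corr (f ∘ h) (h^* a * b)],
    which is the multiplication rule of the twisted group ring
    ([graph_corr_comp]).  As [Rf] is [graph_corr f 1] and [Da] is
    [graph_corr id a], the same rule yields [Rg ∘ Da = graph_corr g a].  So
    [[g]a |-> Rg ∘ Da] extends to a ring homomorphism, the sum of the maps
    [graph_corr g] over the automorphisms [g].

    It is bijective for an additive reason.  Base change along the pullback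
    squares of a lextensive category shows that the pushforwards along the
    inclusions of a coproduct are inverse to the restrictions, so
    [E] of the finite coproduct of copies of [X] indexed by [Aut X] is the
    direct sum of the [E X], through pushforward ([cprd_sum_inj],
    [cprd_sum_surj]).  When [X] is Galois this coproduct is [X × X] through
    the maps [(id, g)]; exchanging the two factors turns these maps into the
    graphs [(g, id)], and pushforward along an isomorphism is bijective. *)

Set Implicit Arguments.
Unset Strict Implicit.
Unset Printing Implicit Defensive.

Import GRing.Theory.
Local Open Scope ring_scope.
Local Open Scope cat_scope.

(** * Correspondences supported on graphs *)

Section GraphCorrespondences.
Variables (C : fincat) (E : gysin C).

Definition graph_corr (A B : C) (f : hom A B) (a : E A) : corr E A B :=
  push E (mpair f (idm A)) a.

(** Pulling the first factor back to the triple product replaces the graph of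
    [f] by that of [f ∘ prd1]; the projection formula for that graph and
    for the graph of [h] then collapses the composite to one pushforward. *)
Lemma graph_corr_comp (A B D : C) (f : hom B D) (h : hom A B)
    (a : E B) (b : E A) :
  corr_comp (graph_corr f a) (graph_corr h b) =
  graph_corr (f ∘ h) (pull E h a * b).
Proof.
pose e : hom (B × A) (D × (B × A)) := mpair (f ∘ prd1 B A) (idm _).
have pbk : is_pullback e (prd1 B A) (pi12 A B D) (mpair f (idm B)).
  apply: is_pullbackI.
  - by rewrite /e /pi12 !pairE.
  - move=> t u v k.
    have := congr1 (mcomp (prd1 _ _)) k; rewrite /pi12 !pairE => k1.
    have := congr1 (mcomp (prd2 _ _)) k; rewrite /pi12 !pairE => k2.
    exists (prd2 _ _ ∘ u); rewrite /e; split; last by [].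
    by apply: prd_ext; rewrite !pairE // k1 -k2.
  - move=> t w w' /(congr1 (mcomp (prd2 _ _))).
    by rewrite /e !pairE.
rewrite /corr_comp /graph_corr -(gysin_mackey pbk) -push_Mpull -push_comp.
rewrite -pull_comp /pi23 /e prd2_pair pull_id -push_pullM -push_comp.
by rewrite -pull_comp /pi13 !pairE.
Qed.

Lemma corr_R_graph (A B : C) (f : hom A B) : corr_R E f = graph_corr f 1.
Proof.
have pbk : is_pullback (mpair f (idm A)) f (mprod (idm B) f) (diag B).
  apply: is_pullbackI.
  - by rewrite /mprod /diag !pairE.
  - move=> t u v k.
    have := congr1 (mcomp (prd1 _ _)) k; rewrite /mprod /diag !pairE => k1.
    have := congr1 (mcomp (prd2 _ _)) k; rewrite /mprod /diag !pairE => k2.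
    exists (prd2 _ _ ∘ u); split; last by rewrite -k2.
    by apply: prd_ext; rewrite !pairE // k1 -k2.
  - by move=> t w w' /(congr1 (mcomp (prd2 _ _))); rewrite !pairE.
by rewrite /corr_R /corr_id -(gysin_mackey pbk) rmorph1.
Qed.

Lemma corr_R_comp_D (A B : C) (f : hom A B) (a : E A) :
  corr_R E f ∘ corr_D a = graph_corr f a.
Proof.
by rewrite corr_R_graph [LHS]graph_corr_comp compm1 rmorph1 mul1r.
Qed.

End GraphCorrespondences.

(** * Pushforward and finite coproducts *)

Section CoproductPushforward.
Variables (C : fincat) (E : gysin C).
Hypothesis lexC : lextensive C.

Lemma is_pullback_sym (a b c d : C) (f : hom a b) (p : hom a c) (q : hom b d)
    (g : hom c d) : is_pullback f p q g -> is_pullback p f g q.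
Proof.
move=> [e un]; split=> // t u v k; have [w [[fw pw] w_un]] := un t v u (esym k).
by exists w; split=> // w' [pw' fw']; apply: w_un.
Qed.

Lemma pull_inj1_push_inj1 (A B : C) (a : E A) :
  pull E (inj1 A B) (push E (inj1 A B) a) = a.
Proof.
have [pbk _ _] := lexC.2 A B.
by rewrite -(gysin_mackey pbk) pull_id push_id.
Qed.

Lemma pull_inj2_push_inj2 (A B : C) (b : E B) :
  pull E (inj2 A B) (push E (inj2 A B) b) = b.
Proof.
have [_ pbk _] := lexC.2 A B.
by rewrite -(gysin_mackey pbk) pull_id push_id.
Qed.

Lemma pull_inj1_push_inj2 (A B : C) (b : E B) :
  pull E (inj1 A B) (push E (inj2 A B) b) = 0.
Proof.
have [_ _ pbk] := lexC.2 A B.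
by rewrite -(gysin_mackey pbk) [pull E _ b]gysin_initial raddf0.
Qed.

Lemma pull_inj2_push_inj1 (A B : C) (a : E A) :
  pull E (inj2 A B) (push E (inj1 A B) a) = 0.
Proof.
have [_ _ /is_pullback_sym pbk] := lexC.2 A B.
by rewrite -(gysin_mackey pbk) [pull E _ a]gysin_initial raddf0.
Qed.

(** Both sides have the same restrictions to the two summands, and these
    detect elements of [E (A ⊔ B)]. *)
Lemma cprd_decomp (A B : C) (c : E (A ⊔ B)) :
  c = push E (inj1 A B) (pull E (inj1 A B) c) +
      push E (inj2 A B) (pull E (inj2 A B) c).
Proof.
apply: (bij_inj (gysin_cprd E A B)) => /=; rewrite !rmorphD.
rewrite pull_inj1_push_inj1 pull_inj2_push_inj2.
by rewrite pull_inj1_push_inj2 pull_inj2_push_inj1 addr0 add0r.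
Qed.

Section Families.
Variables (I : eqType) (F : I -> C).

Fixpoint cprd_sum (u : forall i, E (F i)) (s : seq I) : E (bigcprd F s) :=
  match s return E (bigcprd F s) with
  | [::] => 0
  | i :: s' => push E (inj1 (F i) (bigcprd F s')) (u i) +
               push E (inj2 (F i) (bigcprd F s')) (cprd_sum u s')
  end.

Lemma push_cprd_sum (T : C) (f : forall i, hom (F i) T)
    (u : forall i, E (F i)) (s : seq I) :
  push E (bigcopair f s) (cprd_sum u s) = \sum_(i <- s) push E (f i) (u i).
Proof.
elim: s => [|i s IHs]; first by rewrite big_nil raddf0.
by rewrite big_cons /= raddfD -!push_comp copair_inj1 copair_inj2 IHs.
Qed.

Lemma eq_cprd_sum (u v : forall i, E (F i)) (s : seq I) :
  {in s, forall i, u i = v i} -> cprd_sum u s = cprd_sum v s.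
Proof.
elim: s => //= i s IHs uv; rewrite uv ?mem_head // IHs // => j js.
by rewrite uv // inE js orbT.
Qed.

Lemma cprd_sum_inj (u v : forall i, E (F i)) (s : seq I) :
  cprd_sum u s = cprd_sum v s -> {in s, forall i, u i = v i}.
Proof.
elim: s => //= i s IHs uv j; rewrite inE => /predU1P[->|js].
  have := congr1 (pull E (inj1 _ _)) uv.
  by rewrite !rmorphD !pull_inj1_push_inj1 !pull_inj1_push_inj2 !addr0.
apply: IHs js; have := congr1 (pull E (inj2 _ _)) uv.
by rewrite !rmorphD !pull_inj2_push_inj1 !pull_inj2_push_inj2 !add0r.
Qed.

(** An index occurring twice in [s] would give two summands but only one value
    of [u], hence the uniqueness hypothesis. *)
Lemma cprd_sum_surj (s : seq I) (c : E (bigcprd F s)) :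
  uniq s -> exists u : forall i, E (F i), cprd_sum u s = c.
Proof.
elim: s c => [|i s IHs] c /=.
  by exists (fun=> 0); rewrite [c]gysin_initial.
case/andP=> nis /(IHs (pull E (inj2 _ _) c))[u uc].
pose v := dfwith u (pull E (inj1 _ _) c).
have vu : {in s, forall j, v j = u j}.
  by move=> j js; rewrite /v dfwith_out //; apply: contraNneq nis => ->.
by exists v; rewrite (eq_cprd_sum vu) uc /v dfwith_in -cprd_decomp.
Qed.

End Families.

End CoproductPushforward.

Lemma push_iso_bij (C : fincat) (E : gysin C) (A B : C) (f : hom A B) :
  is_iso f -> bijective (push E f).
Proof.
case=> g [gf fg]; exists (push E g) => x.
  by rewrite -push_comp gf push_id.
by rewrite -push_comp fg push_id.
Qed.

Lemma swap_is_iso (C : fincat) (A B : C) :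
  is_iso (mpair (prd2 A B) (prd1 A B)).
Proof.
by exists (mpair (prd2 B A) (prd1 B A)); split; apply: prd_ext; rewrite !pairE.
Qed.

(** * The twisted group ring acting by correspondences *)

Section TwistedToCorrespondences.
Variables (C : fincat) (E : gysin C) (X : C).
Variables (s : seq (aut X)) (s_enum : enumerates s).

(** Summing over all of [s] rather than over the support of [u] makes
    additivity immediate.  The enumeration hypothesis is an argument so that
    the ring homomorphism structure can be attached to this constant. *)
Definition twisted_corr of enumerates s := fun u : twisted E X =>
  \sum_(g <- s) graph_corr g u@_g : corr_end E X.

Local Notation phi := (twisted_corr s_enum).

Fact twisted_corr_is_additive : zmod_morphism phi.
Proof.
move=> u v; rewrite /twisted_corr -sumrB; apply: eq_bigr => g _.
by rewrite mcoeffB [LHS]raddfB.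
Qed.

HB.instance Definition _ :=
  GRing.isZmodMorphism.Build (twisted E X) (corr_end E X) phi
    twisted_corr_is_additive.

Lemma twisted_corr_tmon (g : aut X) (a : E X) :
  phi (tmon g a) = graph_corr g a.
Proof.
have [s_uniq s_all] := s_enum.
rewrite /twisted_corr (bigD1_seq g) //= mcoeffUU big1 ?addr0 // => h hg.
by rewrite mcoeffU eq_sym (negPf hg) [LHS]raddf0.
Qed.

Fact twisted_corr_is_multiplicative : monoid_morphism phi.
Proof.
split; first exact: twisted_corr_tmon.
move=> u v; elim/twisted_ind: u => [|u u' IH IH'|g a].
- by rewrite mul0r raddf0 mul0r.
- by rewrite mulrDl !raddfD mulrDl /= IH IH'.
elim/twisted_ind: v => [|v v' IH IH'|h b].
- by rewrite mulr0 raddf0 mulr0.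
- by rewrite mulrDr !raddfD mulrDr /= IH IH'.
by rewrite [tmon g a * _]tmonM !twisted_corr_tmon [RHS]graph_corr_comp.
Qed.

HB.instance Definition _ :=
  GRing.isMonoidMorphism.Build (twisted E X) (corr_end E X) phi
    twisted_corr_is_multiplicative.

Hypothesis lexC : lextensive C.
Hypothesis iso_s :
  is_iso (bigcopair (F := fun=> X) (fun g : aut X => mpair (idm X) g) s).

(** The exchange of factors turns the components [(id, g)] of the Galois
    isomorphism into the graphs [(g, id)]. *)
Lemma sum_graph_corr_cprd_sum (u : aut X -> E X) :
  \sum_(g <- s) graph_corr g (u g) =
  push E (mpair (prd2 X X) (prd1 X X))
    (push E (bigcopair (F := fun=> X) (fun g : aut X => mpair (idm X) g) s)
       (cprd_sum (F := fun=> X) u s)).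
Proof.
rewrite push_cprd_sum raddf_sum; apply: eq_bigr => g _.
by rewrite -push_comp /graph_corr !pairE.
Qed.

Lemma twisted_corr_bij : bijective phi.
Proof.
have [s_uniq s_all] := s_enum.
have swap_bij := push_iso_bij E (swap_is_iso X X).
have cop_bij := push_iso_bij E iso_s.
have phi_inj : injective phi.
  move=> u v; rewrite /twisted_corr.
  rewrite (sum_graph_corr_cprd_sum (fun g => u@_g)).
  rewrite (sum_graph_corr_cprd_sum (fun g => v@_g)).
  move=> /(bij_inj swap_bij)/(bij_inj cop_bij)/(cprd_sum_inj lexC) uv.
  by apply/malgP => g; apply: uv.
have phi_surj c : exists u, phi u = c.
  have [swap' _ swapK] := swap_bij; have [cop' _ copK] := cop_bij.
  have [u uc] := cprd_sum_surj lexC (cop' (swap' c)) s_uniq.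
  exists (\sum_(g <- s) tmon g (u g)); rewrite raddf_sum.
  rewrite (eq_bigr _ (fun g _ => twisted_corr_tmon g (u g))).
  by rewrite [LHS]sum_graph_corr_cprd_sum uc copK swapK.
have invK c : phi (sval (cid (phi_surj c))) = c by case: cid.
by exists (fun c => sval (cid (phi_surj c))) => // u; apply: phi_inj.
Qed.

End TwistedToCorrespondences.

Theorem proposition1p4 (C : fincat) (hC : galoisien C) (E : gysin C)
    (X : C) (hX : galois X) :
  exists phi : {rmorphism twisted E X -> corr_end E X},
    bijective phi /\
    forall (g : aut X) (a : E X),
      phi (tmon g a) = (corr_R E g ∘ corr_D a)%cat.
Proof.
have [lexC _ _ _] := hC; have [s [s_enum iso_s]] := hX.
exists (twisted_corr s_enum : {rmorphism twisted E X -> corr_end E X}); split.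
  exact: twisted_corr_bij.
by move=> g a; rewrite corr_R_comp_D; apply: twisted_corr_tmon.
Qed.
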